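(* Let $0\le\lambda<n$ and $1\le p<\infty$. If $f\in V_0L^{p,\lambda}\cap V_\infty L^{p,\lambda}$ is uniformly continuous on $\mathbb{R}^n$, then $f$ can be approximated in the norm $\|\cdot\|_{p,\lambda}$ by functions from $V_0L^{p,\lambda}\cap V_\infty L^{p,\lambda}\cap C^\infty(\mathbb{R}^n)$.
   Context: $B(x,r)$ is the open ball in $\mathbb{R}^n$ with center $x$ and radius $r$. For $f\in L^1_{\mathrm{loc}}(\mathbb{R}^n)$ let $\mathfrak{M}_{p,\lambda}(f;x,r):=r^{-\lambda}\int_{B(x,r)}|f(y)|^p\,dy$. The homogeneous Morrey space $L^{p,\lambda}(\mathbb{R}^n)$ consists of $f\in L^p_{\mathrm{loc}}(\mathbb{R}^n)$ with $\|f\|_{p,\lambda}:=\sup_{x\in\mathbb{R}^n,\,r>0}\mathfrak{M}_{p,\lambda}(f;x,r)^{1/p}<\infty$. $V_0L^{p,\lambda}=\{f\in L^{p,\lambda}:\lim_{r\to0}\sup_{x}\mathfrak{M}_{p,\lambda}(f;x,r)=0\}$ and $V_\infty L^{p,\lambda}=\{f\in L^{p,\lambda}:\lim_{r\to\infty}\sup_{x}\mathfrak{M}_{p,\lambda}(f;x,r)=0\}$. *)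

(* Defs.v *)
From HB Require Import structures.
From mathcomp Require Import all_boot all_order all_algebra.
From mathcomp Require Import all_classical all_reals all_analysis.
Set Implicit Arguments. Unset Strict Implicit. Unset Printing Implicit Defensive.
Import Order.TTheory GRing.Theory Num.Theory.
Import numFieldNormedType.Exports.
Local Open Scope classical_set_scope.
Local Open Scope ring_scope.

Section Morrey.
Variable R : realType.

(* R^n is modelled by 'rV[R]_n (for the differential structure); the
   measurable structure lives on n.-tuple R (product sigma-algebra). *)
Definition rv_of_tuple n (t : n.-tuple R) : 'rV[R]_n := \row_i tnth t i.

Definition enorm n (v : 'rV[R]_n) : R := Num.sqrt (\sum_i (v ord0 i) ^+ 2).
Definition eball n (x : 'rV[R]_n) (r : R) : set 'rV[R]_n :=
  [set y | enorm (y - x) < r].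

(* Lebesgue integral over R^n of a nonnegative function, realised as the
   iterated one-dimensional Lebesgue integral (equal to the integral w.r.t.
   n-dimensional Lebesgue measure for nonnegative measurable integrands,
   by Tonelli). *)
Fixpoint iint (n : nat) : (n.-tuple R -> \bar R) -> \bar R :=
  match n return (n.-tuple R -> \bar R) -> \bar R with
  | 0 => fun g => g [tuple]
  | m.+1 => fun g =>
      (\int[lebesgue_measure]_(s in [set: R]) iint (fun t : m.-tuple R => g [tuple of s :: t]))%E
  end.

Definition Rn_integral n (g : 'rV[R]_n -> \bar R) : \bar R :=
  iint (fun t => g (rv_of_tuple t)).

Definition Rn_measurable n (f : 'rV[R]_n -> R) : Prop :=
  measurable_fun [set: n.-tuple R] (fun t => f (rv_of_tuple t)).

Definition morreyM n (p lam : R) (f : 'rV[R]_n -> R) (x : 'rV[R]_n) (r : R)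
  : \bar R :=
  ((r `^ (- lam))%:E *
   Rn_integral (fun y => (\1_(eball x r) y * (`|f y| `^ p))%:E))%E.

Definition supM n (p lam : R) (f : 'rV[R]_n -> R) (r : R) : \bar R :=
  ereal_sup [set morreyM p lam f x r | x in [set: 'rV[R]_n]].

Definition morrey_norm n (p lam : R) (f : 'rV[R]_n -> R) : \bar R :=
  ((ereal_sup [set z | exists x (r : R), (0 < r)%R /\ z = morreyM p lam f x r])
     `^ (p^-1))%E.

Definition in_morrey n (p lam : R) (f : 'rV[R]_n -> R) : Prop :=
  Rn_measurable f /\ (morrey_norm p lam f < +oo)%E.

Definition in_V0 n (p lam : R) (f : 'rV[R]_n -> R) : Prop :=
  in_morrey p lam f /\ supM p lam f r @[r --> 0^'+] --> 0%E.

Definition in_Vinf n (p lam : R) (f : 'rV[R]_n -> R) : Prop :=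
  in_morrey p lam f /\ supM p lam f r @[r --> +oo] --> 0%E.

Definition unif_cont n (f : 'rV[R]_n -> R) : Prop :=
  forall e : R, 0 < e -> exists2 d : R, 0 < d &
    forall x y : 'rV[R]_n, enorm (x - y) < d -> `|f x - f y| < e.

Fixpoint iter_partial n (l : seq 'I_n) (f : 'rV[R]_n -> R) : 'rV[R]_n -> R :=
  match l with
  | [::] => f
  | i :: l' => 'D_(delta_mx ord0 i) (iter_partial l' f)
  end.

Definition smooth n (f : 'rV[R]_n -> R) : Prop :=
  forall l : seq 'I_n,
    continuous (iter_partial l f) /\
    forall (i : 'I_n) (x : 'rV[R]_n), derivable (iter_partial l f) x (delta_mx ord0 i).

End Morrey.

(* Main.v *)
(** Mollification estimates are avoided: [f] is first shrunk towards [0] by a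
    small [delta], then averaged smoothly at a scale where [f] oscillates by
    less than [delta].  The average [g] lies between [0] and [f] pointwise and
    within [2 delta] of it.  Hence [g] and [f - g] have Morrey quotients bounded
    by those of [f]: this puts [g] in both vanishing spaces, and makes the
    quotients of [f - g] small for [r] near [0] and near infinity.  On the
    remaining compact range of radii the uniform bound [|f - g| <= 2 delta]
    suffices, since [delta] is chosen after that range.  The average is a
    locally finite sum over a lattice, normalised by the sum of its weights
    [exp (-1 / (d^2 - |x - node|^2))]. *)

Require Import Defs.
From HB Require Import structures.
From mathcomp Require Import all_boot all_order all_algebra.
From mathcomp Require Import all_classical all_reals all_analysis.
From mathcomp Require Import measurable_realfun.
From mathcomp Require Import zify ring lra.
Set Implicit Arguments. Unset Strict Implicit. Unset Printing Implicit Defensive.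
Import Order.TTheory GRing.Theory Num.Theory.
Import numFieldNormedType.Exports.
Local Open Scope classical_set_scope.
Local Open Scope ring_scope.

(** * Chain rule for directional derivatives *)

Section DirectionalDerivative.
Context {R : realType} {V : normedModType R}.

(** Restricting to the line through [x] makes the one-variable chain rule applicable; the two
    difference quotients are the same function of [h]. *)
Lemma derive_line (f : V -> R) (x v : V) :
  'D_v f x = 'D_1 (fun h : R => f (h *: v + x)) 0.
Proof.
rewrite /derive; set g1 := fun h => h^-1 *: _; set g2 := fun h => h^-1 *: _.
suff -> : g1 = g2 by [].
by apply/funext => h; rewrite /g1 /g2 /= addr0 scale0r add0r [_%:A]mulr1.
Qed.

Lemma is_derive_comp1 (phi : R -> R) (u : V -> R) (x v : V) :
  derivable phi (u x) 1 -> derivable u x v ->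
  is_derive x v (phi \o u) ('D_1 phi (u x) * 'D_v u x).
Proof.
move=> dphi /derivable1P du.
have dphi' : derivable phi ((fun h : R => u (h *: v + x)) 0) 1.
  by rewrite /= scale0r add0r.
have := @is_derive1_comp R phi (fun h : R => u (h *: v + x)) 0 _ _
  (derivableP dphi') (derivableP du).
rewrite /= scale0r add0r => -[dc vc].
by apply: DeriveDef; [apply/derivable1P | rewrite !derive_line].
Qed.

End DirectionalDerivative.

Lemma near_eq_continuous (T U : topologicalType) (f g : T -> U) (x : T) :
  (\forall y \near x, f y = g y) ->
  {for x, continuous g} -> {for x, continuous f}.
Proof.
move=> fg cg; rewrite /prop_for /continuous_at (nbhs_singleton fg); apply: cvg_trans cg.
by apply: near_eq_cvg; apply: filterS fg => y ->.
Qed.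

(** * Functions of class C^k and their closure properties *)

Section FiniteOrderSmoothness.
Context {R : realType}.
Implicit Types (k n : nat).

Fixpoint C1_order k (phi : R -> R) : Prop :=
  match k with
  | 0 => continuous phi
  | k'.+1 => (forall x, derivable phi x 1) /\ C1_order k' ('D_1 phi)
  end.

(** Recursion on a finite order lets products, inverses and composites be treated by induction, with
    lists of directions appearing only in [smooth_Cn_order]. Continuity is asked at every level
    because partial derivatives alone do not give it; in one variable derivability does. *)
Fixpoint Cn_order n k (f : 'rV[R]_n -> R) : Prop :=
  match k with
  | 0 => continuous f
  | k'.+1 => continuous f /\
      forall i, (forall x, derivable f x (delta_mx ord0 i)) /\
        Cn_order k' ('D_(delta_mx ord0 i) f)
  end.

Lemma C1_order_continuous k phi : C1_order k phi -> continuous phi.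
Proof.
case: k => [//|k] [dphi _] x.
exact/differentiable_continuous/derivable1_diffP.
Qed.

Variable n : nat.
Implicit Types f g u : 'rV[R]_n -> R.

Lemma Cn_orderW k f : Cn_order k.+1 f -> Cn_order k f.
Proof.
elim: k f => [|k IH] f [cf df]; first exact: cf.
by split=> // i; have [? /IH] := df i; split.
Qed.

Lemma smooth_Cn_order f : (forall k, Cn_order k f) -> smooth f.
Proof.
move=> Cf l; have {}Cf : forall k, Cn_order k (iter_partial l f).
  elim: l => [//|i l IH] k /=.
  by have [_ /(_ i)[_]] := IH k.+1.
split; first exact: (Cf 0%N).
by move=> i x; have [_ /(_ i)[]] := Cf 1%N.
Qed.

Lemma Cn_order_cst k (c : R) : Cn_order k (cst c : 'rV[R]_n -> R).
Proof.
elim: k c => [|k IH] c; first by move=> x; exact: cst_continuous.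
split; first by move=> x; exact: cst_continuous.
move=> i; split; first by move=> x; exact: derivable_cst.
have -> : 'D_(delta_mx ord0 i) (cst c : 'rV[R]_n -> R) = cst 0.
  by apply/funext => x; rewrite derive_cst.
exact: IH.
Qed.

Lemma Cn_orderD k f g : Cn_order k f -> Cn_order k g -> Cn_order k (f + g).
Proof.
elim: k f g => [|k IH] f g.
  by move=> cf cg x; apply: continuousD; [exact: cf|exact: cg].
move=> [cf df] [cg dg]; split.
  by move=> x; apply: continuousD; [exact: cf|exact: cg].
move=> i; have [df1 df2] := df i; have [dg1 dg2] := dg i; split.
  by move=> x; exact: derivableD.
have -> : 'D_(delta_mx ord0 i) (f + g) =
    'D_(delta_mx ord0 i) f + 'D_(delta_mx ord0 i) g.
  by apply/funext => x; rewrite deriveD.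
exact: IH.
Qed.

Lemma Cn_orderM k f g : Cn_order k f -> Cn_order k g -> Cn_order k (f * g).
Proof.
elim: k f g => [|k IH] f g.
  by move=> cf cg x; apply: continuousM; [exact: cf|exact: cg].
move=> Cf Cg; have [cf df] := Cf; have [cg dg] := Cg; split.
  by move=> x; apply: continuousM; [exact: cf|exact: cg].
move=> i; have [df1 df2] := df i; have [dg1 dg2] := dg i; split.
  by move=> x; exact: derivableM.
have -> : 'D_(delta_mx ord0 i) (f * g) =
    f * 'D_(delta_mx ord0 i) g + g * 'D_(delta_mx ord0 i) f.
  by apply/funext => x; rewrite deriveM.
by apply: Cn_orderD; apply: IH => //; exact: Cn_orderW.
Qed.

(** The derivative [- f^-2 * D f] involves only the inverse itself, at a lower order, and [D f], so
    the induction closes. *)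
Lemma Cn_orderV k f : (forall x, f x != 0) -> Cn_order k f ->
  Cn_order k (fun x => (f x)^-1).
Proof.
move=> f0; elim: k => [|k IH].
  by move=> cf x; apply: continuousV; [exact: f0|exact: cf].
move=> Cf; have [cf df] := Cf; split.
  by move=> x; apply: continuousV; [exact: f0|exact: cf].
move=> i; have [df1 df2] := df i; split.
  by move=> x; exact: derivableV.
have -> : 'D_(delta_mx ord0 i) (fun x => (f x)^-1) =
    cst (-1) * ((fun x => (f x)^-1) * (fun x => (f x)^-1)) *
      'D_(delta_mx ord0 i) f.
  apply/funext => x; rewrite deriveV// !fctE /GRing.scale/=.
  by rewrite mulN1r expr2 invfM.
have CV : Cn_order k (fun x => (f x)^-1) by apply: IH; exact: Cn_orderW.
by apply: Cn_orderM => //; apply: Cn_orderM; [exact: Cn_order_cst|exact: Cn_orderM].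
Qed.

Lemma Cn_order_comp k (phi : R -> R) u :
  C1_order k phi -> Cn_order k u -> Cn_order k (phi \o u).
Proof.
elim: k phi => [|k IH] phi Cphi Cu; last have [cu du] := Cu.
  by move=> x; apply: continuous_comp; [exact: Cu|exact: Cphi].
have [dphi Cdphi] := Cphi; split.
  move=> x; apply: continuous_comp; first exact: cu.
  exact: (C1_order_continuous Cphi).
move=> i; have [du1 du2] := du i; split.
  by move=> x; have [] := is_derive_comp1 (dphi (u x)) (du1 x).
have -> : 'D_(delta_mx ord0 i) (phi \o u) =
    ('D_1 phi \o u) * 'D_(delta_mx ord0 i) u.
  by apply/funext => x; have [_ ->] := is_derive_comp1 (dphi (u x)) (du1 x).
by apply: Cn_orderM => //; apply: IH => //; exact: Cn_orderW.
Qed.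

Lemma Cn_order_coord k (i : 'I_n) :
  Cn_order k (fun x : 'rV[R]_n => x ord0 i).
Proof.
case: k => [|k]; first by move=> x; exact: coord_continuous.
split; first by move=> x; exact: coord_continuous.
move=> j.
have D (x : 'rV[R]_n) :
    is_derive x (delta_mx ord0 j) (fun y : 'rV[R]_n => y ord0 i) (j == i)%:R.
  suff H : (fun h : R => h^-1 *: (((fun y : 'rV[R]_n => y ord0 i) \o shift x)
      (h *: delta_mx ord0 j) - x ord0 i)) @ 0^' --> ((j == i)%:R : R).
    by apply: DeriveDef; [apply/cvg_ex; eexists; exact: H | exact: cvg_lim].
  (* For nonzero [h] the difference quotient of a coordinate is already this constant. *)
  apply: (@cvg_trans _ (cst ((j == i)%:R : R) @ (0 : R)^')); last exact: cvg_cst.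
  apply: near_eq_cvg.
  near=> h; rewrite /= !mxE eqxx/= addrK eq_sym /GRing.scale/=.
  by rewrite mulKf//; near: h; exact: nbhs_dnbhs_neq.
split; first by move=> x; have [] := D x.
have -> : 'D_(delta_mx ord0 j) (fun y : 'rV[R]_n => y ord0 i) = cst (j == i)%:R.
  by apply/funext => x; have [_ ->] := D x.
exact: Cn_order_cst.
Unshelve. all: by end_near. Qed.

Lemma Cn_order_sum k (I : Type) (r : seq I) (F : I -> 'rV[R]_n -> R) :
  (forall i, Cn_order k (F i)) -> Cn_order k (fun x => \sum_(i <- r) F i x).
Proof.
move=> CF; have -> : (fun x => \sum_(i <- r) F i x) = \sum_(i <- r) F i.
  by apply/funext => x; rewrite fct_sumE.
apply: big_ind; [exact: (Cn_order_cst k 0)|exact: Cn_orderD|by move=> i _].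
Qed.

(** Functions that agree near [x] agree near every point of a smaller neighbourhood, so their
    partial derivatives also agree near [x]. This reduces locally finite sums to finite ones. *)
Lemma Cn_order_local k f :
  (forall x : 'rV[R]_n, exists2 g, Cn_order k g & \forall y \near x, f y = g y) ->
  Cn_order k f.
Proof.
elim: k f => [|k IH] f loc.
  move=> x; have [g cg fg] := loc x.
  exact: near_eq_continuous (cg x).
split.
  move=> x; have [g [cg _] fg] := loc x.
  exact: near_eq_continuous (cg x).
move=> i; split=> [x|].
  have [g [_ /(_ i)[dg _]] fg] := loc x.
  apply: near_eq_derivable (dg x).
  by apply: filterS fg => y ->.
apply: IH => x; have [g [_ /(_ i)[_ Cg]] fg] := loc x.
exists ('D_(delta_mx ord0 i) g) => //.
have := nbhs_interior fg; apply: filterS => y fgy.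
exact: near_eq_derive.
Qed.

End FiniteOrderSmoothness.

(** * The functions [P(1/t) exp(-1/t)], extended by zero to [t <= 0] *)

Section FlatExponential.
Context {R : realType}.
Implicit Types P Q : {poly R}.

(* This family is closed under derivation, which makes its members smooth. *)
Definition flat_exp P (t : R) : R :=
  if 0 < t then P.[t^-1] * expR (- t^-1) else 0.

Lemma flat_exp_eq0 P (t : R) : t <= 0 -> flat_exp P t = 0.
Proof. by rewrite /flat_exp ltNge => ->. Qed.

(** With [u = 1/t], the exponential series gives [exp u >= u^(j+1) / (j+1)!]; dividing leaves one
    spare factor [1/u = t]. *)
Lemma expXn_expRN_le (j : nat) (t : R) : 0 < t ->
  t^-1 ^+ j * expR (- t^-1) <= j.+1`!%:R * t.
Proof.
move=> t0; have u0 : 0 <= t^-1 by rewrite invr_ge0 ltW.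
rewrite expRN ler_pdivrMr ?expR_gt0//.
have f0 : (0 : R) < j.+1`!%:R by rewrite ltr0n fact_gt0.
have := expR_ge1Dxn j u0 => h.
have : j.+1`!%:R * t * (t^-1 ^+ j.+1 / j.+1`!%:R) <= j.+1`!%:R * t * expR t^-1.
  by rewrite ler_pM2l ?mulr_gt0//; lra.
by apply: le_trans; rewrite exprS; rewrite le_eqVlt; apply/orP; left;
  apply/eqP; field; rewrite !gt_eqF.
Qed.

(** The monomial estimate is summed over the coefficients of [P]. A bound linear in [|t|] gives
    continuity at [0] for the whole family. *)
Lemma flat_exp_bound P : exists2 C : R, 0 <= C &
  forall t, `|flat_exp P t| <= C * `|t|.
Proof.
exists (\sum_(j < size P) `|P`_j| * j.+1`!%:R).
  by apply: sumr_ge0 => j _; rewrite mulr_ge0.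
move=> t; rewrite /flat_exp; case: ifPn => t0; last first.
  by rewrite normr0 mulr_ge0// sumr_ge0// => j _; rewrite mulr_ge0.
rewrite horner_coef mulr_suml (gtr0_norm t0) mulr_suml.
apply: le_trans (ler_norm_sum _ _ _) _; apply: ler_sum => j _.
rewrite -mulrA normrM -mulrA ler_wpM2l//.
rewrite ger0_norm ?mulr_ge0 ?expR_ge0 ?exprn_ge0 ?invr_ge0 ?(ltW t0)//.
exact: expXn_expRN_le.
Qed.

Lemma flat_exp_cvg0 P : flat_exp P t @[t --> (0 : R)] --> (0 : R).
Proof.
have [C C0 bd] := flat_exp_bound P.
have C1 : 0 < C + 1 by rewrite ltr_wpDl.
apply/cvgr0Pnorm_lt => e e0; near=> t.
apply: le_lt_trans (bd t) _.
have : `|t| < e / (C + 1).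
  near: t; exists (e / (C + 1)); rewrite /= ?divr_gt0// => s /=.
  by rewrite sub0r normrN.
rewrite ltr_pdivlMr// => h; apply: le_lt_trans h.
by rewrite mulrC ler_wpM2l// lerDl.
Unshelve. all: by end_near. Qed.

(** For [t > 0] and [u = 1/t], one has [du/dt = - u^2], so [P(u) exp(-u)] has derivative
    [u^2 (P - P')(u) exp(-u)]. *)
Lemma is_derive_flat_exp P (t : R) :
  is_derive t 1 (flat_exp P) (flat_exp ('X^2 * (P - P^`())) t).
Proof.
have [t0|t0|t0] := ltgtP t 0.
- apply: (@near_eq_is_derive _ _ _ (cst 0)).
    near=> s; have s0 : s < 0 by near: s; exact: lt_nbhsl.
    by rewrite /flat_exp ltNge (ltW s0).
  by rewrite flat_exp_eq0 ?(ltW t0)//; exact: is_derive_cst.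
- apply: (@near_eq_is_derive _ _ _
    ((fun s : R => P.[s^-1]) * (fun s : R => expR (- s^-1)))).
    near=> s; rewrite /flat_exp fctE ifT//.
    by near: s; exact: lt_nbhsr.
  have dV : is_derive t 1 (fun s : R => s^-1) (- t ^- 2).
    apply: is_derive_eq; first by apply: is_deriveV; rewrite gt_eqF.
    by rewrite [_ *: _]mulr1.
  have dP : is_derive t 1 (fun s : R => P.[s^-1]) (P^`().[t^-1] * - t ^- 2).
    exact: (@is_derive1_comp R (horner P) (fun s => s^-1)).
  have dE : is_derive t 1 (fun s : R => expR (- s^-1))
      (expR (- t^-1) * t ^- 2).
    apply: (@is_derive1_comp R expR (fun s => - s^-1)).
    by apply: is_derive_eq; rewrite opprK.
  have dM := is_deriveM dP dE; apply: (is_derive_eq dM).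
  rewrite /flat_exp t0 !hornerE /GRing.scale/= !exprVn.
  by ring.
- rewrite t0 (flat_exp_eq0 _ (lexx 0)); apply/is_derive1_caratheodory.
  (* Multiplying the polynomial by ['X] divides by [t], so this is the slope from [0], and it tends
     to [0]. *)
  exists (flat_exp ('X * P)); split.
  + move=> z; rewrite /flat_exp ltxx !subr0; case: ifPn => [z0|_]; last by rewrite mul0r.
    by rewrite !hornerE; field; rewrite gt_eqF.
  + rewrite /prop_for /continuous_at (flat_exp_eq0 _ (lexx 0)); exact: flat_exp_cvg0.
  + by rewrite /flat_exp ltxx.
Unshelve. all: by end_near. Qed.

Lemma C1_order_flat_exp k P : C1_order k (flat_exp P).
Proof.
have d Q t : derivable (flat_exp Q) t 1 by have [] := is_derive_flat_exp Q t.
elim: k P => [|k IH] P.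
  by move=> x; exact/differentiable_continuous/derivable1_diffP.
split=> //; have -> : 'D_1 (flat_exp P) = flat_exp ('X^2 * (P - P^`())).
  by apply/funext => t; have [_ ->] := is_derive_flat_exp P t.
exact: IH.
Qed.

Lemma flat_exp1_gt0 (t : R) : (0 < flat_exp 1 t) = (0 < t).
Proof.
by rewrite /flat_exp; case: ifPn; rewrite ?ltxx// hornerC mul1r expR_gt0.
Qed.

Lemma flat_exp1_ge0 (t : R) : 0 <= flat_exp 1 t.
Proof.
by rewrite /flat_exp; case: ifPn => // _; rewrite hornerC mul1r expR_ge0.
Qed.

End FlatExponential.

(** * Continuous functions are measurable for the product sigma-algebra *)

Section ContinuousMeasurable.
Context {R : realType}.

Lemma bigcup_countType_measurable d (T : measurableType d) (I : countType)
    (F : I -> set T) :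
  (forall i, measurable (F i)) -> measurable (\bigcup_i F i).
Proof.
move=> mF.
have -> : \bigcup_i F i =
    \bigcup_k (if (unpickle k : option I) is Some i then F i else set0).
  apply/seteqP; split=> [t [i _ Fit]|t [k _]].
    by exists (pickle i); rewrite // pickleK.
  by case: unpickle => // i Fit; exists i.
by apply: bigcupT_measurable => k; case: unpickle.
Qed.

(** An open set is the countable union of the rational boxes it contains, and a box is a finite
    intersection of measurable coordinate slabs. *)
Lemma open_Rn_measurable n (U : set 'rV[R]_n) : open U ->
  measurable [set t : n.-tuple R | U (rv_of_tuple t)].
Proof.
move=> oU.
pose box (q : {ffun 'I_n -> rat} * nat) : set 'rV[R]_n :=
  [set x | forall i, `|x ord0 i - ratr (q.1 i)| < q.2.+1%:R^-1].
pose F q : set (n.-tuple R) :=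
  if `[< box q `<=` U >] then [set t | box q (rv_of_tuple t)] else set0.
have -> : [set t : n.-tuple R | U (rv_of_tuple t)] = \bigcup_q F q.
  apply/seteqP; split=> [t /= Ut|t [q _]]; last first.
    by rewrite /F; case: asboolP => // qU /qU.
  set x := rv_of_tuple t in Ut.
  have /nbhs_ballP[e /= e0 eU] : nbhs x U by exact: open_nbhs_nbhs.
  have e2 : 0 < e / 2 by rewrite divr_gt0.
  (* In each coordinate both [x] and any point of the box lie within this half-width of the rational
     centre, hence within [e] of each other. *)
  have [k ke] : exists k : nat, k.+1%:R^-1 < e / 2.
    by have [k] := ltr_add_invr e2; rewrite add0r; exists k.
  have kp : (0 : R) < k.+1%:R^-1 by rewrite invr_gt0.
  have /choice[q qP] : forall i : 'I_n, exists q : rat,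
      `|x ord0 i - ratr q| < k.+1%:R^-1.
    move=> i; move: kp; set d := _^-1 => d0.
    have : x ord0 i - d < x ord0 i + d by lra.
    move=> /rat_in_itvoo[q]; rewrite in_itv/= => /andP[q1 q2]; exists q.
    by rewrite ltr_norml; apply/andP; split; lra.
  exists ([ffun i => q i], k) => //; rewrite /F asboolT /=.
    by move=> i; rewrite /= ffunE.
  move=> y yq; apply: eU; split=> // i j; rewrite (ord1 i).
  have := yq j; have := qP j; move: ke; rewrite /= ffunE /ball/=; set d := _^-1 => ke.
  rewrite !ltr_norml => /andP[? ?] /andP[? ?].
  by apply/andP; split; lra.
apply: bigcup_countType_measurable => q; rewrite /F; case: asboolP => // _.
have -> : [set t | box q (rv_of_tuple t)] =
    \bigcap_(i : 'I_n) ((fun t => tnth t i) @^-1`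
      `]ratr (q.1 i) - q.2.+1%:R^-1, ratr (q.1 i) + q.2.+1%:R^-1[%classic).
  apply/seteqP; split=> [t tq i _|t tq i] /=.
    have := tq i; rewrite /= mxE in_itv/= ltr_norml; set d := _^-1 => /andP[? ?].
    by apply/andP; split; lra.
  have := tq i I; rewrite /= mxE in_itv/= ltr_norml; set d := _^-1 => /andP[? ?].
  by apply/andP; split; lra.
apply: fin_bigcap_measurable; first exact: finite_finset.
move=> i _; rewrite -[_ @^-1` _]setTI.
exact: (measurable_tnth i measurableT).
Qed.

Lemma continuous_Rn_measurable n (g : 'rV[R]_n -> R) :
  continuous g -> Rn_measurable g.
Proof.
move=> /continuousP cg; apply: (measurability _ (RGenOpens.measurableE R)).
move=> _ [_ [a [b ->] <-]]; rewrite setTI.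
have oI : open `]a, b[%classic by exact: interval_open.
exact: (open_Rn_measurable (cg _ oI)).
Qed.

End ContinuousMeasurable.

(** * Monotonicity of the iterated integral and the volume of a cube *)

Section IteratedIntegral.
Context {R : realType}.
Local Open Scope ereal_scope.

Import HBNNSimple.

(* The integral of a nonnegative function is the supremum of the integrals of
   the simple functions below it, whether or not the function is measurable. *)
Lemma le_integral_nonneg d (T : measurableType d)
    (mu : {measure set T -> \bar R}) (g1 g2 : T -> \bar R) :
  (forall x, 0 <= g1 x) -> (forall x, g1 x <= g2 x) ->
  \int[mu]_x g1 x <= \int[mu]_x g2 x.
Proof.
move=> g10 g12; have g20 x : 0 <= g2 x by exact: le_trans (g12 x).
rewrite !ge0_integralTE//; apply: le_ereal_sup => _ [h /= hg1 <-].
by exists h => // x; exact: le_trans (g12 x).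
Qed.

Lemma iint_ge0 n (g : n.-tuple R -> \bar R) : (forall t, 0 <= g t) -> 0 <= iint g.
Proof.
elim: n g => [|n IH] g g0 //=; apply: integral_ge0 => s _.
by apply: IH => t; exact: g0.
Qed.

Lemma le_iint n (g1 g2 : n.-tuple R -> \bar R) :
  (forall t, 0 <= g1 t) -> (forall t, g1 t <= g2 t) -> iint g1 <= iint g2.
Proof.
elim: n g1 g2 => [|n IH] g1 g2 g10 g12 //=.
apply: le_integral_nonneg => s; first by apply: iint_ge0 => t; exact: g10.
by apply: IH => t; [exact: g10|exact: g12].
Qed.

(** Integrating out the first coordinate turns its indicator into part of the constant and shifts
    the centres; hence the general [c] and the indexing of [a] by [nat]. *)
Lemma iint_box n (c r : R) (a : nat -> R) : (0 <= c)%R -> (0 <= r)%R ->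
  iint (fun t : n.-tuple R =>
    (c * \prod_(i < n) \1_(`[(a i - r)%R, (a i + r)%R]%classic) (tnth t i))%:E) =
  (c * (r *+ 2) ^+ n)%:E.
Proof.
move=> c0 r0; elim: n a c c0 => [|n IH] a c c0 /=.
  by rewrite big_ord0.
under eq_integral => s _.
  rewrite (_ : (fun t : n.-tuple R => _) = fun t : n.-tuple R =>
    ((c * \1_(`[(a 0%N - r)%R, (a 0%N + r)%R]%classic) s) *
      \prod_(i < n) \1_(`[(a i.+1 - r)%R, (a i.+1 + r)%R]%classic)
        (tnth t i))%:E); last first.
    apply/funext => t; rewrite big_ord_recl tnth0 mulrA.
    by under eq_bigr do rewrite tnthS.
  rewrite (IH (fun k => a k.+1)) ?mulr_ge0//.
  rewrite mulrAC EFinM.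
  over.
rewrite ge0_integralZl_EFin//.
- rewrite integral_indic// setIT.
  rewrite [X in _ * X](_ : _ = lebesgue_measure `[(a 0%N - r)%R, (a 0%N + r)%R]%classic)//.
  rewrite lebesgue_measure_itv/= lte_fin.
  case: ltP => h; rewrite -EFinM ?mule0; congr EFin.
    by rewrite exprS; ring.
  (* The interval formula yields [0] unless the endpoints are strictly ordered; as [0 <= r], this is
     the degenerate cube. *)
  have -> : r = 0%R by lra.
  by rewrite exprS mul0rn mul0r !mulr0.
- by apply/measurable_EFinP; exact: measurable_indic.
- by rewrite mulr_ge0// exprn_ge0// mulrn_wge0.
Qed.

End IteratedIntegral.

(** * Smooth averages over a lattice *)

Section LocalAverage.
Context {R : realType} (n : nat).

Lemma enorm_ltE (v : 'rV[R]_n) (d : R) : 0 < d ->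
  (enorm v < d) = (\sum_i v ord0 i ^+ 2 < d ^+ 2).
Proof.
move=> d0; rewrite /enorm -[X in _ < X](gtr0_norm d0) -sqrtr_sqr.
by rewrite ltr_sqrt// exprn_gt0.
Qed.

Lemma finite_bounded_ffun_int (M : nat) :
  finite_set [set k : {ffun 'I_n -> int} | forall i, `|k i| <= M%:Z].
Proof.
pose shift (f : {ffun 'I_n -> 'I_(M + M).+1}) : {ffun 'I_n -> int} :=
  [ffun i => (f i)%:Z - M%:Z].
apply: (@sub_finite_set _ _ (shift @` setT)); last first.
  by apply: finite_image; exact: finite_finset.
move=> k kM; exists [ffun i => inord (absz (k i + M%:Z))] => //.
apply/ffunP => i; rewrite !ffunE.
have := kM i; rewrite ler_norml => /andP[h1 h2].
have e : Posz (absz (k i + M%:Z)) = k i + M%:Z by rewrite gez0_abs//; lia.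
rewrite inordK; first by rewrite e addrK.
by lia.
Qed.

Variable d : R.
Hypothesis d0 : 0 < d.

(* Cubes of this side have Euclidean diameter less than [d]. *)
Let h : R := d / n.+1%:R.
Let node (k : {ffun 'I_n -> int}) : 'rV[R]_n := \row_i ((k i)%:~R * h).
(** The squared distance is polynomial in the coordinates, so no square root has to be
    differentiated. *)
Let w (k : {ffun 'I_n -> int}) (x : 'rV[R]_n) : R :=
  flat_exp 1 (d ^+ 2 - \sum_i (x ord0 i - node k ord0 i) ^+ 2).

Let h0 : 0 < h. Proof. by rewrite divr_gt0. Qed.

Let w_ge0 k x : 0 <= w k x. Proof. exact: flat_exp1_ge0. Qed.

Let w_gt0 k x : (0 < w k x) = (enorm (x - node k) < d).
Proof.
rewrite flat_exp1_gt0 subr_gt0 enorm_ltE//.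
by congr (_ < _); apply: eq_bigr => i _; rewrite !mxE.
Qed.

(** Rounding every coordinate down to the lattice gives a node at squared distance at most
    [n h^2 = d^2 n / (n+1)^2 < d^2]. *)
Let w_cover x : exists k, 0 < w k x.
Proof.
exists [ffun i => Num.floor (x ord0 i / h)].
rewrite flat_exp1_gt0 subr_gt0.
apply: (@le_lt_trans _ _ (\sum_(i < n) h ^+ 2)).
  apply: ler_sum => i _; rewrite !mxE ffunE.
  have /andP[fl fr] := floor_itv (x ord0 i / h).
  rewrite ler_pdivlMr// in fl.
  rewrite ltr_pdivrMr// intrD mulrDl mul1r in fr.
  by rewrite lerXn2r ?nnegrE ?(ltW h0)//; lra.
rewrite sumr_const card_ord /h expr_div_n.
rewrite -[X in X < _]mulr_natr -mulrA gtr_pMr ?exprn_gt0// mulrC ltr_pdivrMr ?exprn_gt0//.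
by rewrite mul1r -natrX ltr_nat expnS expn1; lia.
Qed.

Let locally_finite (x0 : 'rV[R]_n) : exists s : seq {ffun 'I_n -> int},
  uniq s /\ \forall x \near x0, forall k, 0 < w k x -> k \in s.
Proof.
(* Bounds the coordinates of every node active near [x0]: the sum dominates each [|x0 ord0 i|], [1]
   allows for moving from [x0] to [x], and [d] for moving from [x] to the node. *)
pose B : R := \sum_i `|x0 ord0 i| + d + 1.
have B0 : 0 <= B / h.
  by rewrite divr_ge0 ?(ltW h0)// !addr_ge0 ?sumr_ge0 ?(ltW d0).
pose M := Num.bound (B / h).
have fM := finite_bounded_ffun_int M.
exists (finmap.enum_fset
  (fset_set [set k : {ffun 'I_n -> int} | forall i, `|k i| <= M%:Z])).
split; first exact: finmap.fset_uniq.
have := nbhsx_ballx x0 1 ltr01; apply: filterS => x -[_ xx0] k wk.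
rewrite in_fset_set// inE /= => i.
have := archi_boundP B0; rewrite -/M ltr_pdivrMr// => BM.
have {}wk : `|x ord0 i - node k ord0 i| < d.
  move: wk; rewrite flat_exp1_gt0 subr_gt0 => wk.
  rewrite -[X in _ < X](gtr0_norm d0) -ltr_sqr ?nnegrE// !real_normK ?num_real//.
  apply: le_lt_trans wk; rewrite (bigD1 i)//= lerDl.
  by apply: sumr_ge0 => j _; exact: sqr_ge0.
have x0i : `|x0 ord0 i| <= \sum_j `|x0 ord0 j|.
  by rewrite (bigD1 i)//= lerDl sumr_ge0.
have := xx0 ord0 i; rewrite /ball/= => {}xx0.
have kB : `|(k i)%:~R * h| < B.
  have -> : (k i)%:~R * h = node k ord0 i by rewrite mxE.
  have := ler_norm (x0 ord0 i); have := ler_norm (- x0 ord0 i).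
  rewrite normrN /B; move: wk xx0; rewrite !ltr_norml => /andP[? ?] /andP[? ?] ? ?.
  by apply/andP; split; lra.
have : `|(k i)%:~R| * h < M%:R * h :> R.
  by apply: lt_trans BM; rewrite normrM (gtr0_norm h0) in kB.
rewrite ltr_pM2r// -intr_norm -[M%:R]/(M%:Z%:~R) ltr_int => /ltW.
exact.
Qed.

(** A finite-support sum over the whole lattice; [locally_finite] supplies the finite support, and
    near each point a single list of indices serves. *)
Let wsum (c : {ffun 'I_n -> int} -> R) (x : 'rV[R]_n) : R :=
  \sum_(k \in [set: {ffun 'I_n -> int}]) c k * w k x.

Let wsum_seq c x (s : seq {ffun 'I_n -> int}) :
  uniq s -> (forall k, 0 < w k x -> k \in s) ->
  wsum c x = \sum_(k <- s) c k * w k x.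
Proof.
move=> us sP; rewrite fsbig_seq//; apply/esym/fsbig_widen => // k [_ ks] /=.
have [wk|] := ltP 0 (w k x); first by have := sP k wk.
by move=> wk; have /eqP -> : w k x == 0; rewrite ?mulr0// eq_le wk w_ge0.
Qed.

Let Cn_order_w m k : Cn_order m (w k).
Proof.
apply: (@Cn_order_comp R n m (flat_exp 1)
  (fun x => d ^+ 2 - \sum_i (x ord0 i - node k ord0 i) ^+ 2)).
  exact: C1_order_flat_exp.
have Cq i : Cn_order m (fun x : 'rV[R]_n => x ord0 i - node k ord0 i).
  apply: (@Cn_orderD R n m (fun x => x ord0 i) (cst (- node k ord0 i))).
    exact: Cn_order_coord.
  exact: Cn_order_cst.
apply: (@Cn_orderD R n m (cst (d ^+ 2))
  (fun x => - \sum_i (x ord0 i - node k ord0 i) ^+ 2)).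
  exact: Cn_order_cst.
have -> : (fun x : 'rV[R]_n => - \sum_i (x ord0 i - node k ord0 i) ^+ 2) =
    cst (-1) * (fun x => \sum_i (x ord0 i - node k ord0 i) ^+ 2).
  by apply/funext => x; rewrite !fctE mulN1r.
apply: Cn_orderM; first exact: Cn_order_cst.
by apply: Cn_order_sum => i; exact: (Cn_orderM (Cq i) (Cq i)).
Qed.

Let Cn_order_wsum m c : Cn_order m (wsum c).
Proof.
apply: Cn_order_local => x0; have [s [us sP]] := locally_finite x0.
exists (fun x => \sum_(k <- s) c k * w k x).
  apply: Cn_order_sum => k.
  by apply: (@Cn_orderM R n m (cst (c k)) (w k)); [exact: Cn_order_cst|exact: Cn_order_w].
by apply: filterS sP => x; exact: wsum_seq.
Qed.

(** The values of [F] enter only as constant coefficients, so smoothness comes from the weights. At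
    [x] only nodes within [d] count, and a weighted mean stays in any interval containing the
    averaged values. *)
Lemma smooth_local_average (F : 'rV[R]_n -> R) :
  exists2 g : 'rV[R]_n -> R, smooth g &
    forall x (a b : R), (forall y, enorm (x - y) < d -> a <= F y <= b) ->
      a <= g x <= b.
Proof.
pose W := wsum (cst 1); pose G := wsum (fun k => F (node k)).
have W0 x : 0 < W x.
  have [s [us /nbhs_singleton sP]] := locally_finite x.
  rewrite /W (wsum_seq _ us sP); have [k wk] := w_cover x.
  rewrite (bigD1_seq k) ?sP//= mul1r ltr_wpDr// sumr_ge0// => j _.
  by rewrite mul1r.
exists (G * (fun x => (W x)^-1)).
  apply: smooth_Cn_order => m; apply: Cn_orderM; first exact: Cn_order_wsum.
  by apply: Cn_orderV; [move=> x; rewrite gt_eqF|exact: Cn_order_wsum].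
move=> x a b Fab; rewrite fctE ler_pdivlMr// ler_pdivrMr//.
have [s [us /nbhs_singleton sP]] := locally_finite x.
rewrite /W /G !(wsum_seq _ us sP) !mulr_sumr.
apply/andP; split; apply: ler_sum => k _; rewrite mul1r;
  have [|] := ltP 0 (w k x).
- by move=> wk; rewrite ler_pM2r//; move: wk; rewrite w_gt0 => /Fab/andP[].
- by move=> wk; have /eqP -> : w k x == 0; rewrite ?mulr0// eq_le wk w_ge0.
- by move=> wk; rewrite ler_pM2r//; move: wk; rewrite w_gt0 => /Fab/andP[].
- by move=> wk; have /eqP -> : w k x == 0; rewrite ?mulr0// eq_le wk w_ge0.
Qed.

End LocalAverage.

(** * Comparison and size estimates for Morrey quotients *)

Section MorreyBounds.
Context {R : realType} (n : nat).
Implicit Types (f g : 'rV[R]_n -> R) (x : 'rV[R]_n).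

Lemma morreyM_ge0 (p lam : R) f x (r : R) : (0 <= morreyM p lam f x r)%E.
Proof.
apply: mule_ge0; first by rewrite lee_fin powR_ge0.
by apply: iint_ge0 => t; rewrite lee_fin mulr_ge0// powR_ge0.
Qed.

Lemma le_morreyM (p lam : R) f g x (r : R) : 0 <= p ->
  (forall y, `|g y| <= `|f y|) -> (morreyM p lam g x r <= morreyM p lam f x r)%E.
Proof.
move=> p0 gf; apply: lee_wpmul2l; first by rewrite lee_fin powR_ge0.
apply: le_iint => t; first by rewrite lee_fin mulr_ge0// powR_ge0.
by rewrite lee_fin ler_wpM2l// ge0_ler_powR// nnegrE.
Qed.

Lemma le_supM (p lam : R) f g (r : R) : 0 <= p ->
  (forall y, `|g y| <= `|f y|) -> (supM p lam g r <= supM p lam f r)%E.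
Proof.
move=> p0 gf; apply: ge_ereal_sup => _ [x _ <-].
by apply: le_trans (le_morreyM lam x r p0 gf) _; apply: ereal_sup_ubound; exists x.
Qed.

Lemma supM_ge0 (p lam : R) f (r : R) : (0 <= supM p lam f r)%E.
Proof.
by apply: le_trans (morreyM_ge0 p lam f 0 r) _; apply: ereal_sup_ubound; exists 0.
Qed.

Lemma morreyM_le_supM (p lam : R) f x (r : R) :
  (morreyM p lam f x r <= supM p lam f r)%E.
Proof. by apply: ereal_sup_ubound; exists x. Qed.

(** For [r0 <= r <= r1] the ball lies in the cube of side [2 r1] about [x], the integrand is at most
    [c^p], and [r^(-lam) <= r0^(-lam)]. *)
Lemma morreyM_le_box (p lam c r0 r1 : R) g x (r : R) :
  0 <= p -> 0 <= lam -> (forall y, `|g y| <= c) -> 0 < r0 -> r0 <= r -> r <= r1 ->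
  (morreyM p lam g x r <= (r0 `^ (- lam) * (c `^ p * (r1 *+ 2) ^+ n))%:E)%E.
Proof.
move=> p0 lam0 gc r00 r0r rr1.
have r1_ge0 : 0 <= r1 by lra.
have c0 : 0 <= c by apply: le_trans (gc 0).
rewrite EFinM; apply: lee_pmul.
- by rewrite lee_fin powR_ge0.
- by apply: iint_ge0 => t; rewrite lee_fin mulr_ge0// powR_ge0.
- rewrite lee_fin !powRN lef_pV2 ?posrE ?powR_gt0//; last by lra.
  by rewrite ge0_ler_powR// nnegrE; lra.
(* The coordinates of [x], padded by [0] to the sequence that [iint_box] expects. *)
pose a k : R := if insub k is Some i then x ord0 i else 0.
rewrite -(iint_box n a (powR_ge0 c p) r1_ge0).
apply: le_iint => t; first by rewrite lee_fin mulr_ge0// powR_ge0.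
rewrite lee_fin mulrC ler_pM ?powR_ge0//.
  by rewrite ge0_ler_powR// nnegrE.
rewrite {1}indicE; have [|_] := boolP (_ \in _); last first.
  by rewrite prodr_ge0// => i _; rewrite indicE ler0n.
rewrite inE /eball/= => tx; rewrite big1// => i _.
rewrite indicE mem_set// /a /= insubT// => lti.
have -> : Sub (i : nat) lti = i by exact/val_inj.
have : `|tnth t i - x ord0 i| <= r1.
  apply: le_trans rr1; apply/ltW; apply: le_lt_trans tx.
  rewrite /enorm -sqrtr_sqr ler_sqrt ?sumr_ge0// => [|j _]; last exact: sqr_ge0.
  rewrite (bigD1 i)//= !mxE lerDl sumr_ge0// => j _; exact: sqr_ge0.
rewrite in_itv/= ler_norml => /andP[? ?].
by apply/andP; split; lra.
Qed.

Lemma in_morrey_le (p lam : R) f g : 0 < p -> Rn_measurable g ->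
  (forall y, `|g y| <= `|f y|) -> in_morrey p lam f -> in_morrey p lam g.
Proof.
move=> p0 mg gf [_ fy]; split=> //; apply: le_lt_trans fy.
have pV : 0 <= p^-1 by rewrite invr_ge0 ltW.
apply: gt0_ler_poweR => //.
- rewrite in_itv/= leey andbT.
  apply: le_trans (morreyM_ge0 p lam g 0 1) _; apply: ereal_sup_ubound.
  by exists 0, 1.
- rewrite in_itv/= leey andbT.
  apply: le_trans (morreyM_ge0 p lam f 0 1) _; apply: ereal_sup_ubound.
  by exists 0, 1.
- apply: ge_ereal_sup => _ [x [r [r0 ->]]].
  apply: le_trans (le_morreyM lam x r (ltW p0) gf) _.
  by apply: ereal_sup_ubound; exists x, r.
Qed.

Lemma morrey_norm_le (p lam eta : R) g : 0 < p -> 0 <= eta ->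
  (forall x (r : R), 0 < r -> (morreyM p lam g x r <= eta%:E)%E) ->
  (morrey_norm p lam g <= (eta `^ p^-1)%:E)%E.
Proof.
move=> p0 eta0 Mg; rewrite -poweR_EFin; apply: gt0_ler_poweR.
- by rewrite invr_ge0 ltW.
- rewrite in_itv/= leey andbT.
  apply: le_trans (morreyM_ge0 p lam g 0 1) _; apply: ereal_sup_ubound.
  by exists 0, 1.
- by rewrite in_itv/= leey andbT lee_fin.
- by apply: ge_ereal_sup => _ [x [r [r0 ->]]]; exact: Mg.
Qed.

(** The filter is kept general to serve both [r --> 0^'+] and [r --> +oo]. *)
Lemma cvg_supM_le (p lam : R) f g (F : set_system R) {FF : Filter F} :
  0 <= p -> (forall y, `|g y| <= `|f y|) ->
  supM p lam f r @[r --> F] --> 0%E -> supM p lam g r @[r --> F] --> 0%E.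
Proof.
move=> p0 gf; apply: squeeze_cvge; last exact: cvg_cst.
by apply: nearW => r; rewrite supM_ge0 le_supM.
Qed.

End MorreyBounds.

(** * Dominated smooth approximation and the resulting norm estimate *)

(* Shrinking [f] towards [0] by [delta] before averaging at a scale where [f]
   oscillates by less than [delta] keeps the average between [0] and [f]. *)
Lemma smooth_dominated_approx (R : realType) (n : nat) (f : 'rV[R]_n -> R)
    (delta : R) :
  unif_cont f -> 0 < delta ->
  exists2 g : 'rV[R]_n -> R, smooth g & forall x,
    [/\ `|g x| <= `|f x|, `|f x - g x| <= `|f x| & `|f x - g x| <= delta *+ 2].
Proof.
move=> fu delta0; have [d d0 fd] := fu delta delta0.
pose F y := if delta < f y then f y - delta
            else if f y < - delta then f y + delta else 0.
have [g sg gP] := smooth_local_average d0 F; exists g => // x.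
(* These bounds depend on [x] only, so the average inherits them. If [F y > 0], then
   [F y = f y - delta < f x], and symmetrically below; moreover [|F y - f y| <= delta], and the
   oscillation adds less than another [delta]. *)
have FP y : enorm (x - y) < d ->
    Num.max (Num.min 0 (f x)) (f x - delta *+ 2) <= F y <=
    Num.min (Num.max 0 (f x)) (f x + delta *+ 2).
  move=> /fd; rewrite /F ltr_norml => /andP[? ?].
  rewrite ge_max ge_min le_min le_max.
  case: ltP => ?; last case: ltP => ?;
    have [?|?] := leP 0 (f x); apply/andP; split; apply/andP; split;
    try (apply/orP; (left; lra) || (right; lra)); lra.
have := gP x _ _ FP; rewrite ge_max ge_min le_min le_max.
by have [fx|fx] := leP 0 (f x);
  [rewrite (ger0_norm fx)|rewrite (ltr0_norm fx)];
  move=> /andP[/andP[/orP[?|?] ?] /andP[/orP[?|?] ?]];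
  split; rewrite ler_norml; apply/andP; split; lra.
Qed.

Theorem theorem5p2 (R : realType) (n : nat) (lam p : R) (f : 'rV[R]_n -> R) :
  0 <= lam -> lam < n%:R -> 1 <= p ->
  in_V0 p lam f -> in_Vinf p lam f -> unif_cont f ->
  forall eps : R, 0 < eps ->
    exists g : 'rV[R]_n -> R,
      [/\ in_V0 p lam g, in_Vinf p lam g, smooth g &
          (morrey_norm p lam (f \- g)%R < eps%:E)%E].
Proof.
move=> lam0 _ p1 [fM f0] [_ foo] fu eps eps0.
have p0 : 0 < p by lra.
have p0' := ltW p0.
(* Quotients bounded by [eta] give norm at most [eps / 2], which leaves room for the strict
   inequality. *)
pose eta := (eps / 2) `^ p.
have eps2 : 0 < eps / 2 by rewrite divr_gt0.
have eta0 : 0 < eta by exact: powR_gt0.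
have nb : nbhs 0%E [set y | (y < eta%:E)%E].
  by apply: open_nbhs_nbhs; split; [exact: open_ereal_lt_ereal|rewrite /= lte_fin].
have [r0 /= r00 fr0] : exists2 r0 : R, 0 < r0 &
    forall r, 0 < r -> r < r0 -> (supM p lam f r < eta%:E)%E.
  have [e /= e0 eP] := f0 _ nb; exists e => // r r0 re; apply: eP => //=.
  by rewrite sub0r normrN gtr0_norm.
have [r1 fr1] : exists r1 : R, forall r, r1 < r -> (supM p lam f r < eta%:E)%E.
  by have [M [_ MP]] := foo _ nb; exists M => r rM; exact: MP.
(* The factor of [c^p] in the cube bound for radii from [r0] to [r1], fixed before [c]. The
   threshold [r1] may be negative, hence the maximum. *)
pose C := r0 `^ (- lam) * (Num.max 0 r1 *+ 2) ^+ n.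
have C0 : 0 <= C by rewrite mulr_ge0 ?powR_ge0// exprn_ge0// mulrn_wge0// le_max lexx.
(* Chosen so that [C c^p <= eta]; the added [1] keeps the denominator positive. *)
pose c := (eta / (C + 1)) `^ p^-1.
have c0 : 0 < c by rewrite powR_gt0// divr_gt0// ltr_wpDl.
have cp : c `^ p = eta / (C + 1).
  rewrite /c -powRrM mulVf ?gt_eqF// powRr1// divr_ge0 ?(ltW eta0)//.
  by rewrite addr_ge0.
(* The approximation loses [2 delta], so [delta = c / 2] gives the uniform error [c]. *)
have c2 : 0 < c / 2 by rewrite divr_gt0.
have [g sg gP] := smooth_dominated_approx fu c2.
have gf y : `|g y| <= `|f y| by have [] := gP y.
have mg : Rn_measurable g.
  by apply: continuous_Rn_measurable; have [] := sg [::].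
have gM := in_morrey_le p0 mg gf fM.
exists g; split => //.
- by split=> //; exact: cvg_supM_le f0.
- by split=> //; exact: cvg_supM_le foo.
have fgf y : `|(f \- g) y| <= `|f y| by have [] := gP y.
apply: (@le_lt_trans _ _ (eta `^ p^-1)%:E); last first.
  by rewrite lte_fin /eta -powRrM divff ?gt_eqF// powRr1 ?(ltW eps2)//; lra.
apply: morrey_norm_le => // [|x r rp]; first exact: ltW.
have fsup : (morreyM p lam (f \- g)%R x r <= supM p lam f r)%E.
  exact: le_trans (le_morreyM lam x r p0' fgf) (morreyM_le_supM _ _ _ _ _).
(* Small and large radii are controlled by the quotients of [f], the remaining ones by the uniform
   error. *)
have [rr0|r0r] := ltP r r0.
  by apply: le_trans fsup _; exact/ltW/fr0.
have [r1r|rr1] := ltP r1 r.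
  by apply: le_trans fsup _; exact/ltW/fr1.
apply: le_trans (@morreyM_le_box R n p lam c r0 (Num.max 0 r1) _ x r _ _ _ _ _ _) _ => //.
- move=> y; have [_ _] := gP y; suff -> : c / 2 *+ 2 = c by [].
  by lra.
- by rewrite le_max rr1 orbT.
rewrite lee_fin mulrCA -/C cp mulrAC ler_pdivrMr ?ltr_wpDl//.
by rewrite ler_pM2l// lerDl.
Qed.
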